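(* Let $\mathcal{A}=((V_i)_{1\le i\le n},E)$ be an $n$-player arena (with a possibly infinite vertex set $V$), let $T_1,\dots,T_n\subseteq V$, let $w\colon E\to\mathbb{N}$ be a weight function and let $\mathcal{G}=(\mathcal{A},(\mathsf{SPath}^{T_i}_{w})_{1\le i\le n})$ be the associated shortest-path game. Let $\sigma'$ be a Nash equilibrium from a vertex $v_0$ in $\mathcal{G}$, with outcome $\pi'=\mathsf{Out}(\sigma',v_0)$. Then there exists a finite-memory Nash equilibrium $\sigma$ from $v_0$ in $\mathcal{G}$ such that $\mathsf{SatPl}(\mathsf{Out}(\sigma,v_0))=\mathsf{SatPl}(\pi')$, such that $\mathsf{SPath}^{T_i}_{w}(\mathsf{Out}(\sigma,v_0))\le \mathsf{SPath}^{T_i}_{w}(\pi')$ for all $i\in\{1,\dots,n\}$, and such that each strategy of $\sigma$ has a memory size of at most $$n\cdot(|\mathsf{VisPos}(\pi')\setminus\{0\}|+2)\ \le\ n^2+2n .$$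
   Context: Arenas. An $n$-player arena ($n\ge 1$) is $\mathcal{A}=((V_i)_{1\le i\le n},E)$ where $V$ is a (possibly infinite) set of vertices, $(V_i)_{1\le i\le n}$ is a partition of $V$ (parts may be empty; $V_i$ is the set of vertices controlled by player $P_i$), $E\subseteq V\times V$, and every vertex has at least one $E$-successor. A play is an infinite sequence $v_0v_1\ldots$ with $(v_\ell,v_{\ell+1})\in E$ for all $\ell\in\mathbb{N}$; a history is a finite non-empty prefix of a play. Strategies. A strategy of $P_i$ is a function $\sigma_i$ mapping each history $h$ ending in $V_i$ to an $E$-successor of the last vertex of $h$. A strategy profile is a tuple $\sigma=(\sigma_i)_{1\le i\le n}$ with one strategy per player. A play $v_0v_1\ldots$ is consistent with $\sigma_i$ if $v_\ell\in V_i$ implies $v_{\ell+1}=\sigma_i(v_0\ldots v_\ell)$ for all $\ell$. $\mathsf{Out}(\sigma,v_0)$ is the unique play from $v_0$ consistent with all strategies of $\sigma$. Finite memory. A Mealy machine of $P_i$ is $(M,m_{\mathsf{init}},\mathsf{up},\mathsf{nxt}_i)$ with $M$ a finite set, $m_{\mathsf{init}}\in M$, $\mathsf{up}\colon M\times V\to M$ and $\mathsf{nxt}_i\colon M\times V_i\to V$. Let $\widehat{\mathsf{up}}(\varepsilon)=m_{\mathsf{init}}$ and $\widehat{\mathsf{up}}(uv)=\mathsf{up}(\widehat{\mathsf{up}}(u),v)$ for $u\in V^*$, $v\in V$. The machine induces the strategy $\sigma_i(h'v)=\mathsf{nxt}_i(\widehat{\mathsf{up}}(h'),v)$ for every history $h'v$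 ending in $v\in V_i$ (with $h'\in V^*$ possibly empty). A strategy is finite-memory if it is induced by a Mealy machine, and has memory size at most $b$ if it is induced by some Mealy machine with $|M|\le b$. A strategy profile is finite-memory if all its strategies are. Costs and equilibria. For a play $\pi=v_0v_1\ldots$, $\mathsf{SPath}^{T}_{w}(\pi)=\sum_{\ell=0}^{r-1}w(v_\ell,v_{\ell+1})$ where $r=\min\{\ell\mid v_\ell\in T\}$ if this minimum exists, and $\mathsf{SPath}^{T}_{w}(\pi)=+\infty$ otherwise. Player $P_i$ aims to minimise the cost function $\mathsf{SPath}^{T_i}_{w}$. $\mathsf{SatPl}(\pi)$ is the set of $i$ such that some vertex of $T_i$ occurs in $\pi$, and $\mathsf{VisPos}(\pi)=\{\min\{\ell\in\mathbb{N}\mid v_\ell\in T_i\}\mid i\in\mathsf{SatPl}(\pi)\}$. A strategy profile $\sigma$ is a Nash equilibrium from $v_0$ if no player has a strategy such that, when this player alone replaces their strategy in $\sigma$ by it, the outcome from $v_0$ has a strictly smaller cost for this player than $\mathsf{Out}(\sigma,v_0)$. *)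

(* Defs.v *)
From HB Require Import structures.
From mathcomp Require Import all_boot all_order all_algebra finmap.
From mathcomp Require Import boolp classical_sets cardinality constructive_ereal.

Set Implicit Arguments.
Unset Strict Implicit.
Unset Printing Implicit Defensive.

Local Open Scope classical_set_scope.
Local Open Scope nat_scope.

(* The partition of the vertices among the players is the family of the fibers
   of [owner]; fibers may be empty. *)
Record arena (n : nat) := Arena {
  vertex :> Type;
  owner : vertex -> 'I_n;
  edge : vertex -> vertex -> Prop;
  edge_total : forall v, exists v', edge v v'
}.

Section Games.
Context {n : nat} {A : arena n}.

Definition play (pi : nat -> A) : Prop := forall l, edge (pi l) (pi l.+1).

Definition history (h : seq A) : Prop :=
  exists2 pi, play pi & exists k, h = mkseq pi k.+1.

(* A nonempty sequence of vertices [rcons h v] is passed as the pair [h], [v].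
   The values of [act] outside histories ending in a vertex of player i are
   irrelevant: no definition below depends on them. *)
Record strategy (i : 'I_n) := Strategy {
  act :> seq A -> A -> A;
  act_edge : forall h v, history (rcons h v) -> owner v = i -> edge v (act h v)
}.

Definition profile := forall i : 'I_n, strategy i.

Definition consistent (i : 'I_n) (s : strategy i) (pi : nat -> A) : Prop :=
  forall l, owner (pi l) = i -> pi l.+1 = s (mkseq pi l) (pi l).

(* First [k.+1] vertices of the outcome, the last one being kept apart. *)
Fixpoint outcome_prefix (s : profile) (v0 : A) (k : nat) : seq A * A :=
  if k is k'.+1 then
    let: (h, v) := outcome_prefix s v0 k' in (rcons h v, s (owner v) h v)
  else ([::], v0).

Definition outcome (s : profile) (v0 : A) (k : nat) : A :=
  (outcome_prefix s v0 k).2.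

(* As for strategies, [next m v] is only relevant when [v]
   belongs to the player that uses the machine. *)
Record mealy := Mealy {
  memory : finType;
  init : memory;
  update : memory -> A -> memory;
  next : memory -> A -> A
}.

Definition update_hat (m : mealy) (u : seq A) : memory m :=
  foldl (@update m) (init m) u.

Definition induces (m : mealy) (i : 'I_n) (s : strategy i) : Prop :=
  forall h v, history (rcons h v) -> owner v = i ->
    s h v = next (update_hat m h) v.

Definition finite_memory (i : 'I_n) (s : strategy i) : Prop :=
  exists m, induces m s.

Definition memory_size_le (i : 'I_n) (s : strategy i) (b : nat) : Prop :=
  exists2 m, induces m s & #|memory m| <= b.

Definition finite_memory_profile (s : profile) : Prop :=
  forall i, finite_memory (s i).

Definition first_visit (T : set A) (pi : nat -> A) : option nat :=
  match pselect (exists l, `[< T (pi l) >]) with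
  | left Tpi => Some (ex_minn Tpi)
  | right _ => None
  end.

(* Only the values of [w] on edges matter when [pi] is a play. Costs live in
   the extended integers in order to reuse their order. *)
Definition spath (w : A -> A -> nat) (T : set A) (pi : nat -> A) : \bar int :=
  if first_visit T pi is Some r
  then ((\sum_(0 <= l < r) w (pi l) (pi l.+1))%N%:Z)%:E%E
  else +oo%E.

Definition SatPl (T : 'I_n -> set A) (pi : nat -> A) : set 'I_n :=
  [set i | exists l, T i (pi l)].

Definition VisPos (T : 'I_n -> set A) (pi : nat -> A) : set nat :=
  [set r | exists2 i, SatPl T pi i & first_visit (T i) pi = Some r].

(* [dfwith s t] is [s] with its i-th component replaced by [t : strategy i]. *)
Definition nash (cost : 'I_n -> (nat -> A) -> \bar int) (s : profile) (v0 : A)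
    : Prop :=
  forall i (t : strategy i),
    ~ (cost i (outcome (dfwith s t) v0) < cost i (outcome s v0))%E.

Lemma outcome_prefixE (s : profile) v0 k :
  outcome_prefix s v0 k = (mkseq (outcome s v0) k, outcome s v0 k).
Proof.
elim: k => [//|k IHk]; rewrite [RHS]surjective_pairing /=.
rewrite /outcome /= -/(outcome s v0) IHk /=; congr pair.
by rewrite -[in RHS]addn1 /mkseq iotaD map_cat cats1.
Qed.

Lemma outcomeS (s : profile) v0 k (v := outcome s v0 k) :
  outcome s v0 k.+1 = s (owner v) (mkseq (outcome s v0) k) v.
Proof. by rewrite {1}/outcome /= outcome_prefixE. Qed.

Lemma outcome_consistent (s : profile) v0 i : consistent (s i) (outcome s v0).
Proof. by move=> l <-; rewrite outcomeS. Qed.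

Lemma history_rcons (h : seq A) v v' :
  history (rcons h v) -> edge v v' -> history (rcons (rcons h v) v').
Proof.
move=> [pi pl [k hk]] evv'.
have [f fE] := choice (@edge_total n A).
pose q l := if l <= k then pi l else iter (l - k.+1) f v'.
have vE : v = pi k.
  have := congr1 (last v) hk; rewrite last_rcons -[k.+1]addn1 /mkseq iotaD.
  by rewrite map_cat last_cat.
exists q.
  move=> l; rewrite /q; case: (ltngtP l k) => [lk|kl|->].
  - exact: pl.
  - by rewrite subSn// iterS; exact: fE.
  - by rewrite subnn -vE.
exists k.+1; rewrite hk -[in RHS](addn1 k.+1) /mkseq iotaD map_cat -cats1.
congr cat; last by rewrite /= /q add0n ltnn subnn.
apply/eq_in_map => l; rewrite mem_iota add0n ltnS /q => /andP[_ ->].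
by [].
Qed.

Lemma history1 (v : A) : history [:: v].
Proof.
have [f fE] := choice (@edge_total n A).
exists (fun l => iter l f v); first by move=> l; exact: fE.
by exists 0.
Qed.

Lemma play_outcome (s : profile) v0 : play (outcome s v0).
Proof.
have mkS (pi : nat -> A) k : mkseq pi k.+1 = rcons (mkseq pi k) (pi k).
  by rewrite -[in LHS]addn1 /mkseq iotaD map_cat cats1.
have H k : history (mkseq (outcome s v0) k.+1).
  elim: k => [|k IHk]; first exact: history1.
  rewrite mkS in IHk; rewrite !mkS; apply: history_rcons => //.
  by rewrite outcomeS; apply: act_edge.
by move=> l; rewrite outcomeS; apply: act_edge => //; rewrite -mkS.
Qed.

Lemma outcome_unique (s : profile) v0 (pi : nat -> A) :
  pi 0 = v0 -> (forall i, consistent (s i) pi) -> pi =1 outcome s v0.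
Proof.
move=> pi0 cpi k; elim/ltn_ind: k => -[//|k] IHk.
rewrite outcomeS (cpi _ _ erefl) -IHk//; congr (s _ _ _).
by apply/eq_in_map => l; rewrite mem_iota => /andP[_ lk]; apply: IHk; apply: ltnW.
Qed.

Lemma first_visit_Some (T : set A) pi r :
  first_visit T pi = Some r <-> T (pi r) /\ forall l, T (pi l) -> r <= l.
Proof.
rewrite /first_visit; case: pselect => [Tpi|nTpi]; last first.
  by split=> // -[Tr _]; case: nTpi; exists r; apply/asboolP.
case: ex_minnP => m /asboolP Tm mmin; split=> [[<-]|[Tr rmin]].
  by split=> // l Tl; apply: mmin; apply/asboolP.
by congr Some; apply/eqP; rewrite eqn_leq rmin// mmin//; apply/asboolP.
Qed.

Lemma finite_VisPos (T : 'I_n -> set A) pi : finite_set (VisPos T pi).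
Proof.
apply: (@sub_finite_set _ _ ((fun i => odflt 0 (first_visit (T i) pi)) @` setT)).
  by move=> r [i _ ri]; exists i => //; rewrite ri.
by apply: finite_image; exact: finite_finset.
Qed.

End Games.

Arguments profile {n} A.
Arguments mealy {n} A.

(* Main.v *)
Require Import Defs.
From mathcomp Require Import all_boot all_order all_algebra finmap.
From mathcomp Require Import boolp classical_sets cardinality constructive_ereal.
From mathcomp Require Import zify.

(* Cut the outcome pi' at the positions where some target is visited first. Stage j
   consists of the set S_j of vertices of the j-th piece, with its last vertex
   a_(j+1). The new profile follows in stage j a shortest path inside S_j to
   a_(j+1), and keeps to the vertices of pi' in the last stage. A machine stores
   the stage and the owner of the last vertex: if the play leaves S_j, that owner
   deviated and is punished by a memoryless coalition strategy.

   Let d_j be the distance to a_(j+1) inside S_j. As long as a deviation stays in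
   the stages, cost so far plus d_j never falls below the sum of d_0(a_0), ...,
   d_j(a_j), by the triangle inequality, so taking shortcuts inside S_j does not
   pay. If a player leaves S_j at a vertex of pi', that vertex was already passed
   by pi', where, sigma' being an equilibrium, this player could not force a cheaper
   end of the play; the coalition preserves this. *)

Set Implicit Arguments.
Unset Strict Implicit.
Unset Printing Implicit Defensive.

Local Open Scope classical_set_scope.
Local Open Scope nat_scope.

(** * Weights of play segments and their relation to costs *)

Section Weights.
Context {n : nat} {A : arena n}.
Implicit Types (w : A -> A -> nat) (T : set A) (pi : nat -> A).

Definition weight w pi l m := \sum_(l <= j < m) w (pi j) (pi j.+1).

Lemma weightnn w pi l : weight w pi l l = 0.
Proof. by rewrite /weight big_geq. Qed.

Lemma weightSr w pi l m :
  l <= m -> weight w pi l m.+1 = weight w pi l m + w (pi m) (pi m.+1).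
Proof. by move=> lm; rewrite /weight big_nat_recr. Qed.

Lemma weightSl w pi l m :
  l < m -> weight w pi l m = w (pi l) (pi l.+1) + weight w pi l.+1 m.
Proof. by move=> lm; rewrite /weight big_ltn. Qed.

Lemma weight_cat w pi l m p :
  l <= m -> m <= p -> weight w pi l p = weight w pi l m + weight w pi m p.
Proof. by move=> lm mp; rewrite /weight (big_cat_nat lm mp). Qed.

Lemma eq_weight w pi pi' l m :
  (forall j, j <= m -> pi j = pi' j) -> weight w pi l m = weight w pi' l m.
Proof.
move=> E; rewrite /weight !big_nat; apply: eq_bigr => j /andP[_ jm].
by rewrite !E// ltnW.
Qed.

Lemma spath_le w T pi m :
  T (pi m) -> (spath w T pi <= (weight w pi 0 m)%:Z%:E)%E.
Proof.
move=> Tm; rewrite /spath; case E: first_visit => [r|]; last first.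
  by move: E; rewrite /first_visit; case: pselect => // -[]; exists m; apply/asboolP.
have [_ /(_ _ Tm) rm] := (first_visit_Some _ _ _).1 E.
rewrite lee_fin lez_nat -/(weight w pi 0 r).
by rewrite (weight_cat w pi (leq0n r) rm) leq_addr.
Qed.

Lemma spath_ge w T pi c :
  (forall m, T (pi m) -> c <= weight w pi 0 m) -> (c%:Z%:E <= spath w T pi)%E.
Proof.
move=> H; rewrite /spath; case E: first_visit => [r|]; last by rewrite leey.
by have [/H Tr _] := (first_visit_Some _ _ _).1 E; rewrite lee_fin lez_nat.
Qed.

Lemma first_visitP T pi :
  (exists2 q, first_visit T pi = Some q & T (pi q)) \/
  first_visit T pi = None /\ forall l, ~ T (pi l).
Proof.
case E: (first_visit T pi) => [q|].
  by left; exists q => //; have [] := (first_visit_Some _ _ _).1 E.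
right; split=> // l Tl; move: E; rewrite /first_visit.
by case: pselect => // -[]; exists l; apply/asboolP.
Qed.

End Weights.

(** * Reachability with a budget, and memoryless punishment *)

Section Forcing.
Context {n : nat} {A : arena n}.
Variables (T : set A) (u : A -> A -> nat) (i : 'I_n).

(* [forces v c]: from v and against all other players, player i can ensure that T
   is reached with cost at most c. The induction is transfinite where another
   player has infinitely many moves. *)
Inductive forces : A -> nat -> Prop :=
| forces_target v c : T v -> forces v c
| forces_own v v' c : owner v = i -> edge v v' -> u v v' <= c ->
    forces v' (c - u v v') -> forces v c
| forces_other v c : owner v <> i -> (forall v', edge v v' -> u v v' <= c) ->
    (forall v', edge v v' -> forces v' (c - u v v')) -> forces v c.

Lemma forces_monotone v c c' : c <= c' -> forces v c -> forces v c'.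
Proof.
move=> cc' H; elim: H c' cc' => {v c}.
- by move=> v c Tv c' _; apply: forces_target.
- move=> v v' c vi e uc _ IH c' cc'; apply: (forces_own vi e); first by lia.
  by apply: IH; lia.
- move=> v c vi uc _ IH c' cc'; apply: forces_other => // v' e.
    by apply: leq_trans (uc _ e) _.
  by apply: IH => //; lia.
Qed.

(** Bounding the budgets by [theta] lets one move per vertex serve for all of them, so the coalition
    need not remember what has been spent. *)
Definition punishes (theta : nat) (g : A -> A) : Prop :=
  forall v c, c <= theta -> owner v <> i -> ~ forces v c -> u v (g v) <= c ->
    ~ forces (g v) (c - u v (g v)).

(* The move at v is chosen against the largest budget c <= theta that is not
   forced; by monotonicity it is good for all the smaller ones. *)
Lemma punishing_move (theta : nat) : exists g : A -> A,
  (forall v, edge v (g v)) /\ punishes theta g.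
Proof.
have ex v : exists v', edge v v' /\
    forall c, c <= theta -> owner v <> i -> ~ forces v c -> u v v' <= c ->
    ~ forces v' (c - u v v').
  have [v1 e1] := edge_total v.
  have [vi|vi] := pselect (owner v = i); first by exists v1.
  have [ex|nex] := pselect (exists c, `[< c <= theta /\ ~ forces v c >]); last first.
    exists v1; split=> // c cth _ nf; case: nex; exists c; exact/asboolP.
  have ub c : `[< c <= theta /\ ~ forces v c >] -> c <= theta by case/asboolP.
  case: (ex_maxnP ex ub) => cm /asboolP[_ nf] cmax.
  (* If every move were affordable within [cm] and left a forced budget, [forces_other] would make
     [cm] forced at [v]. *)
  have [v' [e nf']] : exists v', edge v v' /\
      (u v v' <= cm -> ~ forces v' (cm - u v v')).
    apply: contrapT => H; apply: nf; apply: forces_other => // v' e.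
      by rewrite leqNgt; apply/negP => lt; apply: H; exists v'; split=> //; lia.
    by apply: contrapT => K; apply: H; exists v'; split.
  exists v'; split=> // c cth _ nfc uc F.
  have ccm : c <= cm by apply: cmax; apply/asboolP.
  apply: nf'; first by lia.
  by apply: forces_monotone F; lia.
by have [g gP] := choice ex; exists g; split=> v; have [gv nf] := gP v.
Qed.

(** Invariant: the unspent budget is not forced. Moves of player i preserve it by [forces_own], the
    other moves by [punishes]; a target would force any budget. *)
Lemma punished_play (theta : nat) (g : A -> A) (rho : nat -> A) (l c : nat) :
  punishes theta g -> play rho ->
  (forall m, l <= m -> owner (rho m) <> i -> rho m.+1 = g (rho m)) ->
  c <= theta -> ~ forces (rho l) c ->
  forall m, l <= m -> weight u rho l m <= c -> ~ T (rho m).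
Proof.
move=> gP prho follow cth nf m lm wm.
suff: ~ forces (rho m) (c - weight u rho l m).
  by apply: contra_not => Tm; apply: forces_target.
elim: m lm wm => [|m IH].
  by rewrite leqn0 => /eqP<-; rewrite weightnn subn0.
rewrite leq_eqVlt => /predU1P[<-|]; first by rewrite weightnn subn0.
rewrite ltnS => lm; rewrite weightSr// => wm F.
have {}IH := IH lm (leq_trans (leq_addr _ _) wm).
have [vi|vi] := pselect (owner (rho m) = i).
  apply: IH; apply: (forces_own vi (prho m)); first by lia.
  by rewrite -subnDA.
have E := follow _ lm vi; rewrite E in wm F.
apply: (gP (rho m) (c - weight u rho l m)) => //; [by lia|by lia|].
by rewrite -subnDA.
Qed.

End Forcing.

(** * Outcomes of unilateral deviations *)

Section Deviation.
Context {n : nat} {A : arena n}.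
Variables (s : profile A) (i : 'I_n) (v0 : A).

Let out (t : strategy i) := outcome (dfwith s t) v0.

Lemma outcome_deviation_own t l :
  owner (out t l) = i -> out t l.+1 = t (mkseq (out t) l) (out t l).
Proof. by rewrite /out outcomeS => ->; rewrite dfwith_in. Qed.

Lemma outcome_deviation_other t l : owner (out t l) <> i ->
  out t l.+1 = s (owner (out t l)) (mkseq (out t) l) (out t l).
Proof. by rewrite /out outcomeS => H; rewrite dfwith_out//; apply/eqP => /esym. Qed.

Lemma outcome_deviation_id : out (s i) =1 outcome s v0.
Proof.
apply: outcome_unique => // j l lj; rewrite -lj.
have [E|E] := pselect (owner (out (s i) l) = i).
  by rewrite outcome_deviation_own// E.
exact: outcome_deviation_other.
Qed.

Lemma divert (t : strategy i) l v' :
  owner (out t l) = i -> edge (out t l) v' ->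
  exists t' : strategy i, (forall j, j <= l -> out t' j = out t j) /\
    out t' l.+1 = v'.
Proof.
move=> li e; set v := out t l in li e *.
(* Testing the length of the history is enough: only one prefix of length [l] occurs along the
   outcome. *)
pose a h x := if `[< size h = l /\ x = v >] then v' else t h x.
have aE h x : history (rcons h x) -> owner x = i -> edge x (a h x).
  by move=> hx xi; rewrite /a; case: asboolP => [[_ ->]//|_]; apply: act_edge.
pose t' := Strategy aE.
have agree j : j <= l -> out t' j = out t j.
  elim/ltn_ind: j => -[//|j] IH jl.
  have Ej : out t' j = out t j by apply: IH => //; exact: ltnW.
  have Em : mkseq (out t') j = mkseq (out t) j.
    apply/eq_in_map => k; rewrite mem_iota => /andP[_ kj].
    by apply: IH; [exact: ltnW|lia].
  have [E|E] := pselect (owner (out t' j) = i).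
    rewrite outcome_deviation_own// Em Ej outcome_deviation_own -?Ej//.
    rewrite /= /a size_mkseq; case: asboolP => // -[jl' _].
    by rewrite jl' ltnn in jl.
  by rewrite outcome_deviation_other// Em outcome_deviation_other -Ej.
exists t'; split=> //; rewrite outcome_deviation_own; last by rewrite agree.
by rewrite /= /a size_mkseq agree//; case: asboolP => // -[].
Qed.

(** Induction on the derivation of [forces]. Only one play against the fixed profile [s] matters, so
    the deviation is built by successive changes at positions from [l] on. *)
Lemma forces_outcome (T : set A) u v c : forces T u i v c ->
  forall t l, out t l = v -> exists t' : strategy i,
    (forall j, j <= l -> out t' j = out t j) /\
    exists m, [/\ l <= m, T (out t' m) & weight u (out t') l m <= c].
Proof.
elim=> {v c} [v c Tv|v v' c vi e uc _ IH|v c vi uc _ IH] t l E.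
- by exists t; split=> //; exists l; rewrite E weightnn.
- rewrite -E in vi e; have [t1 [a1 E1]] := divert vi e.
  have [t2 [a2 [m [lm Tm wm]]]] := IH _ _ E1.
  exists t2; split=> [j jl|]; first by rewrite a2 ?a1// ltnW.
  exists m; split=> //; first exact: ltnW.
  by rewrite weightSl// (a2 l)// a1// E (a2 l.+1)// E1; lia.
(* At a vertex of another player the strategy stays as it is, and the induction hypothesis is used
   for the move that [s] makes. *)
- have e : edge v (out t l.+1) by rewrite -E; apply: play_outcome.
  have [t2 [a2 [m [lm Tm wm]]]] := IH _ e _ _ erefl.
  exists t2; split=> [j jl|]; first by rewrite a2// ltnW.
  exists m; split=> //; first exact: ltnW.
  by rewrite weightSl// (a2 l)// E (a2 l.+1)//; have := uc _ e; lia.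
Qed.

End Deviation.

(** * Shortest paths inside a set of vertices *)

Section ShortestPath.
Context {n : nat} {A : arena n}.
Variables (w : A -> A -> nat) (S : set A) (e : A).

Inductive path_to : A -> nat -> nat -> Prop :=
| path_to_nil : path_to e 0 0
| path_to_step v v' c m : S v -> S v' -> edge v v' -> path_to v' c m ->
    path_to v (w v v' + c) m.+1.

Lemma path_to_first v c m : path_to v c m -> v = e \/
  exists v' c' m', [/\ S v', edge v v', path_to v' c' m' &
    c = w v v' + c' /\ m = m'.+1].
Proof. by case=> [|v1 v' c' m' _]; [left|right; exists v', c', m']. Qed.

(* Among the paths of least weight we follow one with fewest edges: as weights
   may vanish, the weight alone would not guarantee that [e] is reached. *)
Lemma shortest_path : (forall v, S v -> exists c m, path_to v c m) ->
  exists (f : A -> A) (d len : A -> nat), [/\ forall v, edge v (f v), d e = 0,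
    forall v v', S v -> S v' -> edge v v' -> d v <= w v v' + d v' &
    forall v, S v -> v <> e ->
      [/\ S (f v), d v = w v (f v) + d (f v) & len (f v) < len v]].
Proof.
move=> reach.
have ex v : exists p : nat * nat, (exists c m, path_to v c m) ->
    path_to v p.1 p.2 /\ forall c m, path_to v c m ->
    p.1 <= c /\ (c = p.1 -> p.2 <= m).
  have [[c [m vcm]]|nex] := pselect (exists c m, path_to v c m); last first.
    by exists (0, 0) => /nex.
  have exc : exists c, `[< exists m, path_to v c m >].
    by exists c; apply/asboolP; exists m.
  case: (ex_minnP exc) => d /asboolP[m' vdm'] dmin.
  have exm : exists m, `[< path_to v d m >] by exists m'; apply/asboolP.
  case: (ex_minnP exm) => l /asboolP vdl lmin.
  exists (d, l) => _; split=> // c1 m1 p1; split=> /= [|c1d].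
    by apply: dmin; apply/asboolP; exists m1.
  by apply: lmin; apply/asboolP; rewrite -c1d.
have [p pP] := choice ex.
have {ex} pS v : S v -> path_to v (p v).1 (p v).2 /\
  forall c m, path_to v c m -> (p v).1 <= c /\ (c = (p v).1 -> (p v).2 <= m).
  by move=> /reach; apply: pP.
have exf v : exists v', edge v v' /\ (S v -> v <> e ->
    [/\ S v', (p v).1 = w v v' + (p v').1 & (p v').2 < (p v).2]).
  have [Sv|nSv] := pselect (S v /\ v <> e); last first.
    by have [v' vv'] := edge_total v; exists v'; split=> // Sv ve; case: nSv.
  have [pv pmin] := pS _ Sv.1.
  have [E|[v' [c [m [Sv' vv' v'cm [Ec Em]]]]]] := path_to_first pv.
    by case: Sv.2.
  exists v'; split=> // _ _.
  have [pv' pmin'] := pS _ Sv'.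
  have [le1 le2] := pmin' _ _ v'cm.
  have [le3 _] := pmin _ _ (path_to_step Sv.1 Sv' vv' pv').
  (* The rest of an optimal path is optimal in weight, so the fewest edges from [v'] are at most
     [m], one less than from [v]. *)
  have cE : c = (p v').1 by lia.
  by split=> //; [rewrite Ec cE|rewrite Em ltnS le2].
have [f fP] := choice exf.
exists f, (fun v => (p v).1), (fun v => (p v).2); split.
- by move=> v; have [] := fP v.
- have pe : exists c m, path_to e c m by exists 0, 0; exact: path_to_nil.
  have [_ pmin] := pP e pe.
  by have [] := pmin _ _ path_to_nil; lia.
- move=> v v' Sv Sv' vv'; have [_ pmin] := pS _ Sv; have [pv' _] := pS _ Sv'.
  by have [] := pmin _ _ (path_to_step Sv Sv' vv' pv').
- by move=> v Sv ve; have [_] := fP v; apply.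
Qed.

End ShortestPath.

(** * The stage machine *)

Section Stages.
Context {n : nat} {A : arena n}.
Variables (w : A -> A -> nat) (k : nat) (a : nat -> A) (S : nat -> set A).
Variables (f : nat -> A -> A) (g : 'I_n -> A -> A).
Hypothesis f_edge : forall j v, edge v (f j v).
Hypothesis g_edge : forall i v, edge v (g i v).

(* A state (p, j) with j <= k means that the play is in stage j, moving inside
   [S j] towards [a j.+1], and that p owns the last vertex; j = k.+1 means that p
   has left a stage and is being punished. *)
Definition stage_update (m : 'I_n * 'I_k.+2) (v : A) : 'I_n * 'I_k.+2 :=
  if m.2 == k.+1 :> nat then m
  else if `[< S m.2 v >] then
    (owner v, inord (if `[< m.2 < k /\ v = a m.2.+1 >] then m.2.+1 else m.2))
  else (m.1, ord_max).

(** A Mealy machine chooses its move before its memory has read the current vertex, so the update is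
    anticipated here. *)
Definition stage_move (m : 'I_n * 'I_k.+2) (v : A) : A :=
  let m' := stage_update m v in
  if m'.2 == k.+1 :> nat then g m'.1 v else f m'.2 v.

Definition stage_mealy : mealy A :=
  @Mealy _ A ('I_n * 'I_k.+2)%type (owner (a 0), ord0) stage_update stage_move.

Lemma stage_profile_edge i (h : seq A) v :
  history (rcons h v) -> owner v = i ->
  edge v (stage_move (update_hat stage_mealy h) v).
Proof. by move=> _ _; rewrite /stage_move; case: ifP. Qed.

Definition stage_profile : profile A := fun i => Strategy (@stage_profile_edge i).

(** The factor [k + 2] counts the stages 0 to [k] and the punishing mode. *)
Lemma stage_profile_memory i : memory_size_le (stage_profile i) (n * (k + 2)).
Proof. by exists stage_mealy => //=; rewrite card_prod !card_ord addn2. Qed.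

Lemma stage_updateP m v : (stage_update m v).2 <= k ->
  [/\ m.2 <= k, S m.2 v, (stage_update m v).1 = owner v &
    [/\ m.2 < k, v = a m.2.+1 & (stage_update m v).2 = m.2.+1 :> nat] \/
    (m.2 < k -> v <> a m.2.+1) /\ (stage_update m v).2 = m.2 :> nat].
Proof.
have := ltn_ord m.2; rewrite /stage_update; case: eqP => [-> _|mk mlt].
  by rewrite ltnn.
case: asboolP => [Sv /= _|_ /=]; last by rewrite ltnn.
have mk' : m.2 <= k by lia.
split=> //; case: asboolP => [[lt vE]|H]; [left|right].
  by split=> //; rewrite inordK.
by split=> [lt vE|]; [apply: H|rewrite inordK// ltnW].
Qed.

(** * Plays in which only player i may depart from the machine *)

Variables (i : 'I_n) (rho : nat -> A).
Hypothesis rho0 : rho 0 = a 0.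
Hypothesis rho_follows : forall l, owner (rho l) <> i ->
  rho l.+1 = stage_move (update_hat stage_mealy (mkseq rho l)) (rho l).
Hypothesis S_start : forall j, j <= k -> S j (a j).
Hypothesis start_neq_end : forall j, j < k -> a j <> a j.+1.
Hypothesis f_stays :
  forall j v, j <= k -> S j v -> (j < k -> v <> a j.+1) -> S j (f j v).

Let state l : 'I_n * 'I_k.+2 := update_hat stage_mealy (mkseq rho l.+1).

Lemma stateS l : state l.+1 = stage_update (state l) (rho l.+1).
Proof. by rewrite /state mkseqS /update_hat foldl_rcons. Qed.

Lemma state0 : state 0 = (owner (a 0), ord0).
Proof.
rewrite /state /update_hat /= /stage_update rho0 /=.
case: asboolP => [_|nS]; last by case: nS; apply: S_start.
case: asboolP => [[k0 /start_neq_end]|_]; first by case.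
by congr pair; apply/val_inj; rewrite /= inordK.
Qed.

Lemma stage_moveE l :
  stage_move (update_hat stage_mealy (mkseq rho l)) (rho l) =
  if (state l).2 == k.+1 :> nat then g (state l).1 (rho l)
  else f (state l).2 (rho l).
Proof. by rewrite /state mkseqS /update_hat foldl_rcons. Qed.

(** On reaching [a j.+1] the machine switches stage at once, and by [start_neq_end] the new stage
    does not end at the same vertex. Hence the end of the current stage is never the current
    vertex. *)
Lemma state_inside l : (state l).2 <= k ->
  [/\ (state l).1 = owner (rho l), S (state l).2 (rho l) &
    (state l).2 < k -> rho l <> a (state l).2.+1].
Proof.
case: l => [|l].
  by rewrite state0 rho0 /=; split=> //; [exact: S_start|exact: start_neq_end].
rewrite stateS => /stage_updateP[mk Sv -> [[lt -> ->]|[ne ->]]]; split=> //.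
  exact: S_start.
exact: start_neq_end.
Qed.

(** By [f_stays] the prescribed moves remain in the stage, so only player i can leave it. *)
Lemma stage_exit l : k < (state l).2 ->
  exists l0, [/\ l0 < l, (state l0).2 <= k, owner (rho l0) = i &
    forall m, l0 < m -> owner (rho m) <> i -> rho m.+1 = g i (rho m)].
Proof.
elim: l => [|l IH]; first by rewrite state0.
have [lk _|lk] := ltnP k (state l).2.
  by have [l0 [l0l H1 H2 H3]] := IH lk; exists l0; split=> //; exact: ltnW.
rewrite stateS => ex.
have [_ Sl nel] := state_inside lk.
have nS : ~ S (state l).2 (rho l.+1).
  move=> Sl1; move: ex; rewrite /stage_update.
  case: eqP lk => [->|_ lk]; first by rewrite ltnn.
  case: asboolP => // _; case: asboolP => [[lt _]|_] /=.
    by rewrite inordK// ltnNge lt.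
  by rewrite inordK; [rewrite ltnNge lk|rewrite ltnS ltnW].
have own : owner (rho l) = i.
  apply: contrapT => no; apply: nS; rewrite (rho_follows no) stage_moveE.
  case: eqP => [E|_]; first by rewrite E ltnn in lk.
  exact: f_stays.
exists l; split=> // m lm no; rewrite (rho_follows no) stage_moveE.
(* The memory is frozen at the exit, still holding the owner of the last vertex inside. *)
suff -> : state m = (i, ord_max) by rewrite /= eqxx.
elim: m lm {no} => // m IHm; rewrite ltnS leq_eqVlt => /predU1P[<-|lm].
  rewrite stateS /stage_update.
  case: eqP lk => [->|_ lk]; first by rewrite ltnn.
  case: asboolP => // _; congr pair.
  by have [-> _ _] := state_inside lk.
by rewrite stateS IHm// /stage_update eqxx.
Qed.

Variable d : nat -> A -> nat.
Hypothesis d_end : forall j, j < k -> d j (a j.+1) = 0.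
Hypothesis d_triangle : forall j v v',
  j <= k -> S j v -> S j v' -> edge v v' -> d j v <= w v v' + d j v'.
Hypothesis rho_play : play rho.

Definition stages_weight j := \sum_(j' < j) d j' (a j').

Lemma stages_weightS j : stages_weight j.+1 = stages_weight j + d j (a j).
Proof. by rewrite /stages_weight big_ord_recr. Qed.

(** Inside a stage the triangle inequality preserves the second bound. At [a j.+1] the distance
    [d j] vanishes, so the second bound for [j] becomes the first for [j.+1]; adding
    [d j.+1 (a j.+1)] gives the second again. *)
Lemma stage_potential l : (state l).2 <= k ->
  stages_weight (state l).2 <= weight w rho 0 l /\
  stages_weight (state l).2.+1 <= weight w rho 0 l + d (state l).2 (rho l).
Proof.
elim: l => [|l IH].
  by rewrite state0 weightnn stages_weightS /stages_weight big_ord0 rho0.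
rewrite stateS => H; have [mk Sv _ cases] := stage_updateP H.
have [W1 W2] := IH mk; have [_ Sl _] := state_inside mk.
have tri := d_triangle mk Sl Sv (rho_play l).
rewrite weightSr//; case: cases => [[lt vE ->]|[_ ->]].
  rewrite [stages_weight _.+2]stages_weightS.
  by rewrite vE d_end// in tri *; lia.
by lia.
Qed.

Variable len : nat -> A -> nat.
Hypothesis f_shortest : forall j v, j < k -> S j v -> v <> a j.+1 ->
  d j v = w v (f j v) + d j (f j v) /\ len j (f j v) < len j v.

(** Along shortest paths, the weight so far plus the distance left does not grow within a stage. *)
Lemma stage_reached :
  (forall l, rho l.+1 = stage_move (update_hat stage_mealy (mkseq rho l)) (rho l)) ->
  forall j, j <= k -> exists l, [/\ (state l).2 = j :> nat, rho l = a j &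
    weight w rho 0 l <= stages_weight j].
Proof.
move=> all_follow; elim=> [_|j IH jk].
  by exists 0; rewrite state0 weightnn.
have [l [sl rl Wl]] := IH (ltnW jk).
have {rl Wl} : weight w rho 0 l + d j (rho l) <= stages_weight j.+1.
  by rewrite stages_weightS rl leq_add2r.
(* Termination of the stage comes from the number of edges left, since the distance may stay
   constant. *)
have [N] := ubnP (len j (rho l)).
elim: N l sl => // N IHN l sl lenN Wl.
have slk : (state l).2 <= k by rewrite sl ltnW.
have [_ Sl nel] := state_inside slk; rewrite sl in Sl nel.
have [dE lenE] := f_shortest jk Sl (nel jk).
have rE : rho l.+1 = f j (rho l).
  by rewrite all_follow stage_moveE sl ltn_eqF// ltnS ltnW.
have Sl1 : S j (rho l.+1) by rewrite rE; apply: f_stays => //; exact: ltnW.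
have WE : weight w rho 0 l.+1 + d j (rho l.+1) <= stages_weight j.+1.
  by rewrite weightSr// -addnA rE -dE.
have sE : (state l.+1).2 =
    (if `[< rho l.+1 = a j.+1 >] then j.+1 else j) :> nat.
  rewrite stateS /stage_update sl ltn_eqF; last by rewrite ltnS ltnW.
  case: (asboolP (S j _)) => // _ /=.
  have -> : `[< j < k /\ rho l.+1 = a j.+1 >] = `[< rho l.+1 = a j.+1 >].
    by apply: asbool_equiv_eq; split=> [[]|].
  by case: asboolP => _; rewrite inordK//; lia.
have [E|ne] := pselect (rho l.+1 = a j.+1).
  exists l.+1; split=> //; first by rewrite sE; case: asboolP.
  exact: leq_trans (leq_addr _ _) WE.
apply: (IHN l.+1) => //; first by rewrite sE; case: asboolP.
by rewrite rE; apply: leq_trans lenE _.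
Qed.

End Stages.

(** * First-visit positions in increasing order *)

Section VisitPositions.
Context {n : nat} {A : arena n}.
Variables (T : 'I_n -> set A) (pi : nat -> A).

Let visits := fset_set (VisPos T pi `\ 0).

Lemma mem_visits q : (q \in visits) = `[< VisPos T pi q /\ q <> 0 >].
Proof.
rewrite in_fset_set; last exact: finite_setD (finite_VisPos _ _).
by apply/idP/asboolP => [/set_mem|] // H; apply/mem_set.
Qed.

Lemma card_visits : #|` visits|%fset <= n.
Proof.
pose q i := odflt 0 (first_visit (T i) pi).
have := @uniq_leq_size _ (enum_fset visits) [seq q i | i <- enum 'I_n] (fset_uniq _).
rewrite size_map size_enum_ord; apply=> r.
rewrite -[r \in _]/(r \in visits) mem_visits => /asboolP[[i _ E] _].
by apply/mapP; exists i; rewrite ?mem_enum// /q E.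
Qed.

(** The positive positions are sorted and 0 is put in front: stage 0 starts there in any case, so a
    target visited at 0 adds no stage. *)
Lemma visit_positions : exists r : nat -> nat, [/\ r 0 = 0,
  forall j, j < #|` visits|%fset -> r j < r j.+1 /\ VisPos T pi (r j.+1) &
  forall q, VisPos T pi q -> exists2 j, j <= #|` visits|%fset & r j = q].
Proof.
pose s := sort leq (enum_fset visits).
have ss : size s = #|` visits|%fset by rewrite size_sort.
have mems q : (q \in s) = `[< VisPos T pi q /\ q <> 0 >].
  by rewrite mem_sort -mem_visits.
have sorted0 : sorted ltn (0 :: s).
  rewrite /= path_sortedE; last exact: ltn_trans.
  rewrite ltn_sorted_uniq_leq sort_uniq fset_uniq sort_sorted ?andbT; last first.
    exact: leq_total.
  by apply/allP => q; rewrite mems => /asboolP[_ /eqP]; rewrite -lt0n.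
exists (nth 0 (0 :: s)); split=> // [j|q Vq]; rewrite -ss.
- move=> js; split.
    by apply: (sorted_ltn_nth ltn_trans 0 sorted0) => //; rewrite inE /= ltnW.
  by have := mem_nth 0 js; rewrite mems => /asboolP[].
- have [->|/eqP q0] := eqVneq q 0; first by exists 0.
  have qs : q \in s by rewrite mems; apply/asboolP.
  by exists (index q s).+1; [rewrite index_mem|rewrite /= nth_index].
Qed.

End VisitPositions.

(** From index [k] on there is no upper bound: the last stage is a whole tail of [pi]. *)
Definition stage_set {T : Type} (pi : nat -> T) (k : nat) (r : nat -> nat)
    (j : nat) : set T :=
  [set v | exists l, [/\ r j <= l, j < k -> l <= r j.+1 & pi l = v]].

(** * Consequences of the given equilibrium *)

Section Equilibrium.
Context {n : nat} {A : arena n}.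
Variables (T : 'I_n -> set A) (w : A -> A -> nat) (v0 : A) (sigma' : profile A).
Hypothesis nash_sigma' : nash (fun i => spath w (T i)) sigma' v0.

Let pi' := outcome sigma' v0.

(** The common prefix up to [l] is split off so that what follows can be compared with budgets
    starting at [pi' l]. *)
Lemma nash_deviation i (t : strategy i) l m :
  (forall j, j <= l -> outcome (dfwith sigma' t) v0 j = pi' j) -> l <= m ->
  T i (outcome (dfwith sigma' t) v0 m) ->
  exists2 q, first_visit (T i) pi' = Some q & weight w pi' 0 q <=
    weight w pi' 0 l + weight w (outcome (dfwith sigma' t) v0) l m.
Proof.
move=> agree lm Tm; set rho := outcome _ _ in agree Tm *.
have [[q fq Tq]|[nfq _]] := first_visitP (T i) pi'; last first.
  exfalso; apply: (nash_sigma' (t := t)).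
  rewrite {2}/spath nfq; apply: Order.POrderTheory.le_lt_trans (spath_le w Tm) _.
  exact: ltry.
exists q => //; rewrite leqNgt; apply/negP => lt.
apply: (nash_sigma' (t := t)).
apply: Order.POrderTheory.le_lt_trans (spath_le w Tm) _.
rewrite /spath fq lte_fin -/(weight w pi' 0 q) ltz_nat.
by rewrite (weight_cat w rho (leq0n l) lm) (eq_weight w _ agree).
Qed.

(** Otherwise some deviation would copy pi' up to [l] and then reach the target for less than pi'
    spends from [l] to [q]. *)
Lemma not_forces_outcome i q l c : first_visit (T i) pi' = Some q -> l <= q ->
  c < weight w pi' l q -> ~ forces (T i) w i (pi' l) c.
Proof.
move=> fq lq cq F.
have [t [agree [m [lm Tm wm]]]] :=
  forces_outcome F (outcome_deviation_id sigma' i v0 l).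
have {}agree j : j <= l -> outcome (dfwith sigma' t) v0 j = pi' j.
  by move=> /agree->; apply: outcome_deviation_id.
have [q' ] := nash_deviation agree lm Tm.
rewrite fq => -[<-]; rewrite (weight_cat w pi' (leq0n l) lq).
by lia.
Qed.

(* Zero weights reduce reaching T at any cost to budget 0: in an infinite arena no
   single punishing move may be good for all budgets with respect to w. *)
Lemma not_forces_unvisited i l c : first_visit (T i) pi' = None ->
  ~ forces (T i) (fun _ _ => 0) i (pi' l) c.
Proof.
move=> nfq F.
have [t [agree [m [lm Tm _]]]] :=
  forces_outcome F (outcome_deviation_id sigma' i v0 l).
have {}agree j : j <= l -> outcome (dfwith sigma' t) v0 j = pi' j.
  by move=> /agree->; apply: outcome_deviation_id.
by have [q'] := nash_deviation agree lm Tm; rewrite nfq.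
Qed.

Variables (k : nat) (r : nat -> nat).
Hypothesis r_visit : forall j, j < k -> r j < r j.+1 /\ VisPos T pi' (r j.+1).

Let a j := pi' (r j).
Let S := stage_set pi' k r.

Lemma stage_start j : S j (a j).
Proof. by exists (r j); split=> // jk; rewrite ltnW// (r_visit jk).1. Qed.

(** The vertex [a j.+1] lies in a target that pi' first visits at [r j.+1], so it does not occur
    earlier on pi'. *)
Lemma stage_start_neq j : j < k -> a j <> a j.+1.
Proof.
move=> /r_visit[lt [i _ /first_visit_Some[Ti rmin]]] E.
by have := rmin (r j); rewrite -/(a j) E leqNgt lt => /(_ Ti).
Qed.

Lemma leq_r j j' : j <= j' -> j' <= k -> r j <= r j'.
Proof.
elim: j' => [|j' IH]; first by rewrite leqn0 => /eqP->.
rewrite leq_eqVlt => /predU1P[->//|jj'] j'k.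
exact: leq_trans (IH jj' (ltnW j'k)) (ltnW (r_visit j'k).1).
Qed.

Lemma stage_moves : exists (f : nat -> A -> A) (d len : nat -> A -> nat), [/\
  forall j v, edge v (f j v),
  forall j v, S j v -> (j < k -> v <> a j.+1) -> S j (f j v),
  forall j, j < k -> d j (a j.+1) = 0,
  forall j v v', S j v -> S j v' -> edge v v' -> d j v <= w v v' + d j v' &
  forall j v, j < k -> S j v -> v <> a j.+1 ->
    d j v = w v (f j v) + d j (f j v) /\ len j (f j v) < len j v].
Proof.
have ex j : exists p : (A -> A) * (A -> nat) * (A -> nat), [/\
    forall v, edge v (p.1.1 v),
    forall v, S j v -> (j < k -> v <> a j.+1) -> S j (p.1.1 v),
    j < k -> p.1.2 (a j.+1) = 0,
    forall v v', S j v -> S j v' -> edge v v' -> p.1.2 v <= w v v' + p.1.2 v' &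
    forall v, j < k -> S j v -> v <> a j.+1 ->
      p.1.2 v = w v (p.1.1 v) + p.1.2 (p.1.1 v) /\ p.2 (p.1.1 v) < p.2 v].
  (* The last stage has no end to reach: [f j] takes the successor of some occurrence of [v] on pi',
     and the zero distance satisfies the triangle inequality. *)
  have [kj|jk] := leqP k j.
    have exf v : exists v', edge v v' /\ (S j v -> S j v').
      have [[l [rl _ E]]|nS] := pselect (S j v); last first.
        by have [v' vv'] := edge_total v; exists v'.
      exists (pi' l.+1); split=> [|_]; first by rewrite -E; apply: play_outcome.
      by exists l.+1; split=> [||//]; [exact: leqW|lia].
    have [f fP] := choice exf.
    exists (f, fun=> 0, fun=> 0); split=> // v; last move=> Sv _.
    - by have [] := fP v.
    - by have [_] := fP v; apply.
  (* The rest of the piece of pi' is itself a path inside [S j]. *)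
  have reach v : S j v -> exists c m, path_to w (S j) (a j.+1) v c m.
    move=> [l [rl /(_ jk) lr <-]].
    have [x] := ubnP (r j.+1 - l); elim: x l rl lr => // x IH l rl lr lx.
    have [E|ne] := eqVneq l (r j.+1).
      by exists 0, 0; rewrite E; apply: path_to_nil.
    have {ne} lt : l < r j.+1 by rewrite ltn_neqAle ne.
    have [||c [m p]] := IH l.+1 _ lt; [exact: leqW|by lia|].
    exists (w (pi' l) (pi' l.+1) + c), m.+1; apply: path_to_step p.
    - by exists l.
    - by exists l.+1; split=> //; exact: leqW.
    - exact: play_outcome.
  have [f [d [len [H1 H2 H3 H4]]]] := shortest_path reach.
  exists (f, d, len); split=> //= [v Sv ne|v _ Sv ne].
    by have [] := H4 v Sv (ne isT).
  by have [] := H4 v Sv ne.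
have [p pP] := choice ex.
exists (fun j => (p j).1.1), (fun j => (p j).1.2), (fun j => (p j).2).
by split=> j; have [] := pP j.
Qed.

(** The budgets met later are below the weight of a segment of pi' ending at [q], hence within the
    bound [weight w pi' 0 q]. *)
Lemma punishing_moves : exists g : 'I_n -> A -> A, [/\
  forall i v, edge v (g i v),
  forall i q, first_visit (T i) pi' = Some q ->
    punishes (T i) w i (weight w pi' 0 q) (g i) &
  forall i, first_visit (T i) pi' = None ->
    punishes (T i) (fun _ _ => 0) i 0 (g i)].
Proof.
have ex i : exists gi : A -> A, [/\ forall v, edge v (gi v),
  forall q, first_visit (T i) pi' = Some q ->
    punishes (T i) w i (weight w pi' 0 q) gi &
  first_visit (T i) pi' = None -> punishes (T i) (fun _ _ => 0) i 0 gi].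
  case: (first_visit (T i) pi') => [q|].
    have [gi [gE gP]] := punishing_move (T i) w i (weight w pi' 0 q).
    by exists gi; split=> // _ [<-].
  by have [gi [gE gP]] := punishing_move (T i) (fun _ _ => 0) i 0; exists gi.
have [g gP] := choice ex.
by exists g; split=> i; have [] := gP i.
Qed.

(** * Lower bounds on the cost of deviations *)

Variables (f : nat -> A -> A) (g : 'I_n -> A -> A) (d : nat -> A -> nat).
Hypothesis f_stays :
  forall j v, S j v -> (j < k -> v <> a j.+1) -> S j (f j v).
Hypothesis d_end : forall j, j < k -> d j (a j.+1) = 0.
Hypothesis d_triangle :
  forall j v v', S j v -> S j v' -> edge v v' -> d j v <= w v v' + d j v'.

(** Triangle inequality along pi', whose piece from [l] to [r j.+1] runs inside [S j]. *)
Lemma distance_le_weight j l : j < k -> r j <= l -> l <= r j.+1 ->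
  d j (pi' l) <= weight w pi' l (r j.+1).
Proof.
move=> jk; have [x] := ubnP (r j.+1 - l); elim: x l => // x IH l lx rl lr.
have [->|ne] := eqVneq l (r j.+1); first by rewrite d_end.
have {ne} lt : l < r j.+1 by rewrite ltn_neqAle ne.
rewrite weightSl//; apply: leq_trans (d_triangle (v' := pi' l.+1) _ _ _) _.
- by exists l.
- by exists l.+1; split=> //; exact: leqW.
- exact: play_outcome.
by rewrite leq_add2l; apply: IH => //; [lia|exact: leqW].
Qed.

Lemma stages_weight_le j j' : j <= j' -> j' <= k ->
  stages_weight a d j' <= stages_weight a d j + weight w pi' (r j) (r j').
Proof.
elim: j' => [|j' IH]; first by rewrite leqn0 => /eqP->; rewrite leq_addr.
rewrite leq_eqVlt => /predU1P[->|]; first by rewrite leq_addr.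
rewrite ltnS => jj' j'k; have {}IH := IH jj' (ltnW j'k).
have r1 := leq_r jj' (ltnW j'k); have r2 := ltnW (r_visit j'k).1.
have : d j' (a j') <= _ := distance_le_weight j'k (leqnn _) r2.
by rewrite stages_weightS (weight_cat w pi' r1 r2); lia.
Qed.

Hypothesis g_punish : forall i q, first_visit (T i) pi' = Some q ->
  punishes (T i) w i (weight w pi' 0 q) (g i).
Hypothesis g_safe : forall i, first_visit (T i) pi' = None ->
  punishes (T i) (fun _ _ => 0) i 0 (g i).

Variables (i : 'I_n) (rho : nat -> A).
Hypothesis r0 : r 0 = 0.
Hypothesis rho0 : rho 0 = v0.
Hypothesis rho_play : play rho.
Hypothesis rho_follows : forall l, owner (rho l) <> i ->
  rho l.+1 =
  stage_move a S f g (update_hat (stage_mealy k a S f g) (mkseq rho l)) (rho l).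

Let rho0a : rho 0 = a 0. Proof. by rewrite rho0 /a r0. Qed.
Let state l : 'I_n * 'I_k.+2 := update_hat (stage_mealy k a S f g) (mkseq rho l.+1).

Let state_insideE l : (state l).2 <= k -> S (state l).2 (rho l) /\
  ((state l).2 < k -> rho l <> a (state l).2.+1).
Proof.
move=> lk.
by have [] := state_inside rho0a (fun j _ => stage_start j) stage_start_neq lk.
Qed.

Let stage_exitE l : k < (state l).2 -> exists l0, [/\ l0 < l, (state l0).2 <= k,
  owner (rho l0) = i &
  forall m, l0 < m -> owner (rho m) <> i -> rho m.+1 = g i (rho m)].
Proof.
apply: (stage_exit rho0a rho_follows) => [j _|j jk|j v _]; first exact: stage_start.
  exact: stage_start_neq.
exact: f_stays.
Qed.

Let potential l : (state l).2 <= k ->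
  stages_weight a d (state l).2 <= weight w rho 0 l /\
  stages_weight a d (state l).2.+1 <= weight w rho 0 l + d (state l).2 (rho l).
Proof.
apply: (stage_potential rho0a) => // [j _|j jk|j v v' _]; first exact: stage_start.
  exact: stage_start_neq.
exact: d_triangle.
Qed.

Let stages_weight_homo : {homo stages_weight a d : j j' / j <= j'}.
Proof.
apply: homo_leq => [//||j]; [exact: leq_trans|].
by rewrite stages_weightS leq_addr.
Qed.

Lemma deviation_cost_ge q j m : first_visit (T i) pi' = Some q -> j <= k ->
  r j = q -> T i (rho m) -> stages_weight a d j <= weight w rho 0 m.
Proof.
move=> fq jk rjq Tm.
have [_ qmin] := (first_visit_Some _ _ _).1 fq.
have [mk|mk] := leqP (state m).2 k.
  have [W _] := potential mk.
  have [jm|mj] := leqP j (state m).2.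
    exact: leq_trans (stages_weight_homo jm) W.
  have mk' := leq_trans mj jk.
  (* In an earlier stage, [rho m] would be a vertex of pi' at a position at most [q]. As [q] is the
     first visit, it would be the end of its stage, which is excluded. *)
  have [[l [_ /(_ mk') lr E]] ne] := state_insideE mk.
  case: (ne mk'); rewrite -E /a; congr pi'; apply/eqP; rewrite eqn_leq lr /=.
  by apply: leq_trans (leq_r mj jk) _; rewrite rjq; apply: qmin; rewrite E.
have [l [lm lk own out]] := stage_exitE mk.
have [W1 W2] := potential lk.
have Wm : weight w rho 0 m =
    weight w rho 0 l + (w (rho l) (rho l.+1) + weight w rho l.+1 m).
  by rewrite (weight_cat w rho (leq0n l) (ltnW lm)) (weightSl w rho lm).
have [jl|lj] := leqP j (state l).2.
  apply: leq_trans (stages_weight_homo jl) (leq_trans W1 _).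
  by rewrite Wm leq_addr.
have lk' := leq_trans lj jk.
have [[l' [rl /(_ lk') lr E]] _] := state_insideE lk.
(* Suppose the visit is cheaper. The potential at the exit together with [D1] and [D2] then leaves,
   from [rho l = pi' l'] on, less than pi' spends from [l'] to [q]. *)
rewrite leqNgt; apply/negP => lt.
have D1 := stages_weight_le lj jk.
have D2 := distance_le_weight lk' rl lr.
have rq := leq_r lj jk; rewrite rjq in D1 rq.
have l'q := leq_trans lr rq.
have cat1 := weight_cat w pi' lr rq.
have cat2 := weight_cat w pi' (leq0n l') l'q.
rewrite E in D2; set c := weight w rho l.+1 m in Wm.
have cq : w (rho l) (rho l.+1) + c < weight w pi' l' q by lia.
have nf := not_forces_outcome fq l'q cq.
have nf' : ~ forces (T i) w i (rho l.+1) c.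
  (* Player i owns the exit vertex, so forcing after the exit would give forcing at [pi' l']. *)
  move=> F; apply: nf; rewrite -/pi' E; apply: (forces_own own (rho_play l)).
    exact: leq_addr.
  by rewrite addKn.
by apply: (punished_play (g_punish fq) rho_play out _ nf' lm (leqnn _) Tm); lia.
Qed.

(** The stages consist of vertices of pi', which avoids [T i]. After an exit, budget 0 under zero
    weights remains unforced forever. *)
Lemma deviation_unvisited m : first_visit (T i) pi' = None -> ~ T i (rho m).
Proof.
move=> nfq.
have nT l : ~ T i (pi' l).
  by have [[q]|[_]] := first_visitP (T i) pi'; [rewrite nfq|apply].
have [mk|mk] := leqP (state m).2 k.
  by have [[l [_ _ <-]] _] := state_insideE mk.
have [l [lm lk own out]] := stage_exitE mk.
have [[l' [_ _ E]] _] := state_insideE lk.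
have nf : ~ forces (T i) (fun _ _ => 0) i (rho l.+1) 0.
  move=> F; apply: (not_forces_unvisited (l := l') (c := 0) nfq).
  by rewrite E; apply: (forces_own (c := 0) own (rho_play l) _ F).
apply: (punished_play (g_safe nfq) rho_play out _ nf lm) => //.
by rewrite /weight big1.
Qed.

End Equilibrium.

(** * Assembling the equilibrium *)

Theorem theorem32 (n : nat) (n_gt0 : 0 < n) (A : arena n)
    (T : 'I_n -> set A) (w : A -> A -> nat) (v0 : A) (sigma' : profile A)
    (nash_sigma' : nash (fun i => spath w (T i)) sigma' v0) :
  let pi' := outcome sigma' v0 in
  let b := n * (#|` fset_set (VisPos T pi' `\ 0)|%fset + 2) in
  (exists sigma : profile A,
    [/\ finite_memory_profile sigma /\
        nash (fun i => spath w (T i)) sigma v0,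
      SatPl T (outcome sigma v0) = SatPl T pi',
      (forall i : 'I_n,
        (spath w (T i) (outcome sigma v0) <= spath w (T i) pi')%E) &
      (forall i : 'I_n, memory_size_le (sigma i) b)]) /\
  b <= n ^ 2 + 2 * n.
Proof.
move=> pi' b; split; last first.
  by rewrite /b mulnDr (mulnC n 2) leq_add2r -mulnn leq_mul2l card_visits orbT.
have [r [r0 r_visit r_surj]] := visit_positions T pi'.
rewrite {}/b; set k := #|` _|%fset in r_visit r_surj *.
have [f [d [len [f_edge f_stays d_end d_triangle f_shortest]]]] :=
  stage_moves w v0 sigma' k r.
have [g [g_edge g_punish g_safe]] := punishing_moves T w v0 sigma'.
pose a j := pi' (r j); pose S := stage_set pi' k r.
pose sigma := stage_profile k a S f_edge g_edge.
pose rho i t := outcome (dfwith sigma (t : strategy i)) v0.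
have follows i t l : owner (rho i t l) <> i -> rho i t l.+1 =
    stage_move a S f g (update_hat (stage_mealy k a S f g) (mkseq (rho i t) l))
      (rho i t l).
  by move=> no; rewrite {1}/rho outcome_deviation_other.
have cost_ge i t q j m : first_visit (T i) pi' = Some q -> j <= k ->
    r j = q -> T i (rho i t m) ->
    stages_weight a d j <= weight w (rho i t) 0 m.
  by apply: (deviation_cost_ge nash_sigma' r_visit f_stays d_end d_triangle
    g_punish) => //; [exact: play_outcome|exact: (follows i t)].
have unvisited i t m : first_visit (T i) pi' = None ->
    ~ T i (rho i t m).
  by apply: (deviation_unvisited nash_sigma' r_visit f_stays g_safe) => //;
    [exact: play_outcome|exact: (follows i t)].
have reached j : j <= k -> exists2 l, outcome sigma v0 l = a j &
    weight w (outcome sigma v0) 0 l <= stages_weight a d j.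
  move=> jk.
  have [|||||l [_ E W]] := @stage_reached n A w k a S f g (outcome sigma v0)
    _ _ _ _ d len f_shortest _ j jk; last by exists l.
  - by rewrite /a r0.
  - by move=> j' _; apply: (stage_start r_visit).
  - by move=> j' j'k; apply: (stage_start_neq r_visit).
  - by move=> j' v _; apply: f_stays.
  - by move=> l; rewrite outcomeS.
have spath_sigma_le i q j : first_visit (T i) pi' = Some q -> j <= k ->
    r j = q ->
    (spath w (T i) (outcome sigma v0) <= (stages_weight a d j)%:Z%:E)%E.
  move=> /first_visit_Some[Tq _] jk rjq; have [l E W] := reached j jk.
  apply: Order.POrderTheory.le_trans (spath_le w (m := l) _) _.
    by rewrite E /a rjq.
  by rewrite lee_fin lez_nat.
have visit i q : first_visit (T i) pi' = Some q -> exists2 j, j <= k & r j = q.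
  move=> fq; apply: r_surj; exists i => //; exists q.
  by have [] := (first_visit_Some _ _ _).1 fq.
exists sigma; split.
- split=> [i|i t].
    by have [m mi _] := stage_profile_memory k a S f_edge g_edge i; exists m.
  apply/negP; rewrite -Order.TotalTheory.leNgt.
  have [[q fq _]|[nfq _]] := first_visitP (T i) pi'.
    (* The value [stages_weight a d j] lies between the cost of sigma and that of the deviation. *)
    have [j jk rjq] := visit i q fq.
    apply: Order.POrderTheory.le_trans (spath_sigma_le i q j fq jk rjq) _.
    by apply: spath_ge => m; apply: cost_ge fq jk rjq.
  rewrite {2}/spath; case E: first_visit => [q|]; last by rewrite leey.
  have [Tq _] := (first_visit_Some _ _ _).1 E.
  by have := unvisited i t q nfq Tq.
- apply/seteqP; split=> i [l Tl].
    have [[q _ Tq]|[nfq _]] := first_visitP (T i) pi'; first by exists q.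
    (* The outcome of sigma is the deviation by [sigma i] itself. *)
    case: (unvisited i (sigma i) l nfq).
    by rewrite /rho (outcome_deviation_id sigma i v0 l).
  have [[q fq Tq]|[_ /(_ _ Tl)//]] := first_visitP (T i) pi'.
  have [j jk rjq] := visit i q fq; have [m E _] := reached j jk.
  by exists m; rewrite E /a rjq.
- move=> i; have [[q fq Tq]|[nfq _]] := first_visitP (T i) pi'; last first.
    by rewrite {2}/spath nfq leey.
  have [j jk rjq] := visit i q fq.
  apply: Order.POrderTheory.le_trans (spath_sigma_le i q j fq jk rjq) _.
  (* Position 0 is written as [r 0] so that [stages_weight_le] from stage 0 compares the shortest
     paths with the pieces of pi'. *)
  rewrite /spath fq lee_fin lez_nat -/(weight w pi' 0 q) -rjq -r0.
  have := stages_weight_le r_visit d_end d_triangle (leq0n j) jk.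
  by rewrite {2}/stages_weight big_ord0.
- move=> i; exact: stage_profile_memory.
Qed.
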